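(* Let $1\le m<n$ and let $\mathcal{T}_n$ be the tangent bundle of $\mathbb{P}^n$. Then the Cox ring of $\mathbb{P}(\mathcal{T}_n\otimes\mathbb{K}^m)$ has the presentation $$\mathcal{R}(\mathbb{P}(\mathcal{T}_n\otimes\mathbb{K}^m))\cong\mathbb{K}[x_j,Y_{ij}\mid 1\le i\le m,\ 0\le j\le n]\Big/\Big\langle\sum_{j=0}^nx_jY_{ij}\ \Big|\ 1\le i\le m\Big\rangle.$$
   Context: The ground field $\mathbb{K}$ is algebraically closed. The convention is $\mathbb{P}(\mathcal{F})=\mathrm{Proj}\,\mathrm{Sym}(\mathcal{F})$, and the Cox ring is $\mathcal{R}(\mathbb{P}(\mathcal{T}_n\otimes\mathbb{K}^m))=\bigoplus_{k\ge0}\bigoplus_{\mathcal{L}\in\mathrm{Pic}(\mathbb{P}^n)}H^0(\mathbb{P}^n,\mathrm{Sym}^k(\mathcal{T}_n\otimes\mathbb{K}^m)\otimes\mathcal{L})$. *)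

(* Defs.v *)
From HB Require Import structures.
From mathcomp Require Import all_boot all_order all_algebra.
From mathcomp Require Import ring zify.
From mathcomp Require Import boolp.
From mathcomp Require Import mpoly mxtens.

Set Implicit Arguments.
Unset Strict Implicit.
Unset Printing Implicit Defensive.

Import GRing.Theory.
Local Open Scope ring_scope.
Local Open Scope quotient_scope.

Notation "x %:F" := (@FracField.tofrac _ x) : ring_scope.

Section FieldIdentities.
Variables (F : fieldType) (xa xb xc xk xi s t v : F).
Hypotheses (xa0 : xa != 0) (xb0 : xb != 0) (xc0 : xc != 0).

Fact jacobian_aux : xa * ((s * xb - xk * t) / xb ^+ 2) = xa / xb * (s - t * (xk / xb)).
Proof. by field. Qed.

Fact jacobian_regular_aux :
  xa / xb * (s - t * (xk / xb)) =
  xa * xa * (s * (xa * xb) - t * (xa * xk)) / (xa * xb) ^+ 2.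
Proof. by field; rewrite xa0 xb0. Qed.

Fact jacobian_comp_aux :
  xa / xb * (s - t * (xi / xb)) * (xb / xc * (v - xk)) =
  xa / xc * (s * (v - xk) - t / xb * (v * xi - xk * xi)).
Proof. by field; rewrite xb0 xc0. Qed.

Fact jacobian_comp_aux2 :
  xa / xc * (s - v * (xk / xc) - t / xb * (xk - xk / xc * xc)) =
  xa / xc * (s - v * (xk / xc)).
Proof. by field; rewrite xb0 xc0. Qed.

End FieldIdentities.

Section JacobianIdentities.
Variables (F : fieldType) (n : nat) (x : 'I_n.+1 -> F).
Hypothesis x0 : forall a, x a != 0.

Definition jac_entry (a b j l : 'I_n.+1) : F :=
  x a / x b * ((j == l)%:R - (j == b)%:R * (x l / x b)).

Fact jac_entry_id a (j l : 'I_n) :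
  jac_entry a a (lift a j) (lift a l) = (j == l)%:R.
Proof.
rewrite /jac_entry (inj_eq lift_inj) [lift a j == a]eq_sym (negPf (neq_lift _ _)).
by rewrite mul0r subr0 divff ?mul1r.
Qed.

Fact jac_entry_comp a b c j k :
  \sum_(i < n) jac_entry a b j (lift b i) * jac_entry b c (lift b i) k =
  jac_entry a c j k.
Proof.
transitivity (\sum_i jac_entry a b j i * jac_entry b c i k).
  rewrite [RHS](bigD1_ord b) //= [X in _ = X + _](_ : _ = 0) ?add0r //.
  by rewrite /jac_entry divff // mulr1 subrr mulr0 mul0r.
rewrite (eq_bigr (fun i => x a / x c *
   ((i == j)%:R * ((i == k)%:R - (i == c)%:R * (x k / x c))
    - (j == b)%:R / x b * ((i == k)%:R * x i - (i == c)%:R * (x k / x c * x i))))); last first.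
  by move=> i _; rewrite /jac_entry [j == i]eq_sym [_ * (_ / _ * x i)]mulrA -jacobian_comp_aux.
have pick (f : 'I_n.+1 -> F) t : \sum_i (i == t)%:R * f i = f t.
  rewrite (bigD1 t) //= eqxx mul1r big1 ?addr0 // => i /negPf ->.
  by rewrite mul0r.
rewrite -big_distrr /= sumrB -big_distrr /= sumrB.
rewrite (pick (fun i => (i == k)%:R - (i == c)%:R * (x k / x c))).
rewrite (pick x) (pick (fun i => x k / x c * x i)) /jac_entry.
by apply: jacobian_comp_aux2.
Qed.

End JacobianIdentities.

(** * Functions on projective space *)

Section ProjectiveSpace.
Variables (K : fieldType) (n : nat).

(* Projective n-space has homogeneous coordinates x_0, ..., x_n and standard
   charts U_a = {x_a != 0}.  Every local section of every O(d) is regarded as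
   an element of the single field K(x_0, ..., x_n). *)
Definition homfrac := {fraction {mpoly K[n.+1]}}.

Definition hcoord (a : 'I_n.+1) : homfrac := ('X_a)%:F.

(* Sections of O(d) over the principal open subset D(g), for g homogeneous:
   the degree d elements of K[x_0, ..., x_n] localized at g. *)
Definition twist_section (d : int) (g : {mpoly K[n.+1]}) (f : homfrac) : Prop :=
  exists (e k l : nat) (p : {mpoly K[n.+1]}),
    [/\ p \is k.-homog, g ^+ e \is l.-homog, d = k%:Z - l%:Z
      & f = p%:F / g%:F ^+ e].

(* Partial derivative of a rational function, by the quotient rule applied to
   the representative chosen by [repr]; [pderiv_frac] below shows that the
   choice is immaterial. *)
Definition pderiv (j : 'I_n.+1) (f : homfrac) : homfrac :=
  let q := repr f in
  ((\n_q)^`M(j) * \d_q - \n_q * (\d_q)^`M(j))%:F / (\d_q)%:F ^+ 2.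

Lemma mpolyX_neq0 (a : 'I_n.+1) : 'X_a != 0 :> {mpoly K[n.+1]}.
Proof.
apply/eqP => /(congr1 (mcoeff U_(a)%MM)).
by rewrite mcoeffX eqxx mcoeff0; apply/eqP/oner_neq0.
Qed.

Lemma hcoord_neq0 a : hcoord a != 0.
Proof. by rewrite /hcoord tofrac_eq0 mpolyX_neq0. Qed.

Lemma quotient_rule_aux (R : comNzRingType) (p q a b p' q' a' b' : R) :
  p * b = a * q -> p' * b + p * b' = a' * q + a * q' ->
  (a' * b - a * b') * q ^+ 2 = (p' * q - p * q') * b ^+ 2.
Proof.
move=> E E'.
have -> : (a' * b - a * b') * q ^+ 2 =
          b * q * (a' * q + a * q') - (a * q) * (b * q' + q * b') by ring.
by rewrite -E' -E; ring.
Qed.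

Lemma pderiv_frac j (p q : {mpoly K[n.+1]}) : q != 0 ->
  pderiv j (p%:F / q%:F) = (p^`M(j) * q - p * q^`M(j))%:F / q%:F ^+ 2.
Proof.
move=> q0; rewrite /pderiv; set r := repr _.
have r0 : \d_r != 0 by [].
have E : p%:F / q%:F = (\n_r)%:F / (\d_r)%:F :> homfrac.
  have {1}<- : \pi_homfrac r = p%:F / q%:F by exact: reprK.
  apply: (mulIf (x := (\d_r)%:F)); first by rewrite tofrac_eq0.
  rewrite divfK ?tofrac_eq0 //.
  unlock FracField.tofrac; rewrite /GRing.mul /= !piE /FracField.mulf.
  apply/eqmodP; rewrite /= FracField.equivfE.
  by rewrite !numden_Ratio ?mulf_neq0 ?oner_eq0 // !mulr1 mulrC.
have {}E : p * \d_r = \n_r * q.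
  apply/eqP; rewrite -tofrac_eq !rmorphM /= -eqr_div ?tofrac_eq0 //.
  exact/eqP.
have E' := congr1 (mderiv j) E; rewrite !mderivM in E'.
apply/eqP; rewrite eqr_div ?expf_neq0 ?tofrac_eq0 //.
rewrite -!rmorphXn -!rmorphM tofrac_eq /=; apply/eqP.
exact: quotient_rule_aux E E'.
Qed.

Section TwistTheory.
Variable g : {mpoly K[n.+1]}.
Hypothesis g0 : g != 0.

Let gF0 e : (g ^+ e)%:F != 0 :> homfrac.
Proof. by rewrite tofrac_eq0 expf_neq0. Qed.

Lemma twist_sectionM d1 d2 f1 f2 : twist_section d1 g f1 ->
  twist_section d2 g f2 -> twist_section (d1 + d2) g (f1 * f2).
Proof.
move=> [e1 [k1 [l1 [p1 [h1 hg1 -> ->]]]]] [e2 [k2 [l2 [p2 [h2 hg2 -> ->]]]]].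
exists (e1 + e2)%N, (k1 + k2)%N, (l1 + l2)%N, (p1 * p2); split.
- exact: dhomogM.
- by rewrite exprD; apply: dhomogM.
- by rewrite !PoszD; ring.
- by rewrite exprD rmorphM /= invfM mulrACA.
Qed.

Lemma twist_sectionD d f1 f2 : twist_section d g f1 ->
  twist_section d g f2 -> twist_section d g (f1 + f2).
Proof.
move=> [e1 [k1 [l1 [p1 [h1 hg1 E1 ->]]]]] [e2 [k2 [l2 [p2 [h2 hg2 E2 ->]]]]].
have Ek : (k2 + l1 = k1 + l2)%N.
  by move: E1 E2; lia.
exists (e1 + e2)%N, (k1 + l2)%N, (l1 + l2)%N, (p1 * g ^+ e2 + p2 * g ^+ e1); split.
- by apply: rpredD; [apply: dhomogM | rewrite -Ek; apply: dhomogM].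
- by rewrite exprD; apply: dhomogM.
- by rewrite E1 !PoszD; ring.
- by rewrite -!rmorphXn /= addf_div // exprD !rmorphD !rmorphM.
Qed.

Lemma twist_sectionC (c : K) : twist_section 0 g (c%:MP%:F).
Proof.
exists 0%N, 0%N, 0%N, c%:MP; split; rewrite ?expr0 ?divr1 ?dhomog1 //.
by rewrite -[c%:MP]mulr1 mul_mpolyC dhomogZ // dhomog1.
Qed.

Lemma twist_sectionN d f : twist_section d g f -> twist_section d g (- f).
Proof.
move=> [e [k [l [p [h hg E ->]]]]]; exists e, k, l, (- p).
by split; rewrite ?rpredN // rmorphN mulNr.
Qed.

End TwistTheory.

Lemma twist_section0 d a : twist_section d 'X_a 0.
Proof.
have hX e : ('X_a : {mpoly K[n.+1]}) ^+ e \is e.-homog.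
  by rewrite -[X in X.-homog]mul1n dhomogMn // dhomogX /= mdeg1.
case: d => d; [exists 0%N, d, 0%N, 0 | exists d.+1, 0%N, d.+1, 0]; split;
  by rewrite ?hX ?rpred0 ?rmorph0 ?mul0r ?subr0 ?sub0r ?NegzE.
Qed.

Lemma twist_section_sum d a (I : Type) (r : seq I) (P : pred I) (F : I -> homfrac) :
  (forall i, P i -> twist_section d 'X_a (F i)) ->
  twist_section d 'X_a (\sum_(i <- r | P i) F i).
Proof.
move=> H; apply: big_ind => //; first exact: twist_section0.
by move=> *; apply: twist_sectionD => //; apply: mpolyX_neq0.
Qed.

Lemma twist_section_direct (a : 'I_n.+1) (u : seq int) (f : int -> homfrac) : uniq u ->
  (forall d, d \in u -> twist_section d 'X_a (f d)) ->
  \sum_(d <- u) f d = 0 -> forall d, d \in u -> f d = 0.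
Proof.
move=> Uu hf S0.
have Xe e : ('X_a : {mpoly K[n.+1]}) ^+ e \is e.-homog.
  by rewrite -[X in X.-homog]mul1n dhomogMn // dhomogX /= mdeg1.
have XF e : hcoord a ^+ e != 0 by rewrite expf_neq0 ?hcoord_neq0.
have [N hN] : exists N : nat, forall d, d \in u -> exists (q : {mpoly K[n.+1]}),
    [/\ exists2 k, q \is k.-homog & d + N%:Z = k%:Z & f d = q%:F / hcoord a ^+ N].
  have stepN d M N q : (M <= N)%N ->
    [/\ exists2 k, q \is k.-homog & d + M%:Z = k%:Z & f d = q%:F / hcoord a ^+ M] ->
    exists (q : {mpoly K[n.+1]}),
    [/\ exists2 k, q \is k.-homog & d + N%:Z = k%:Z & f d = q%:F / hcoord a ^+ N].
    move=> le [[k hk Ek] ->]; exists (q * 'X_a ^+ (N - M)); split.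
      exists (k + (N - M))%N; first exact: dhomogM.
      by move: Ek le; lia.
    rewrite -{2}(subnKC le) exprD rmorphM rmorphXn /= -mulf_div.
    by rewrite -/(hcoord a) (divff (XF (N - M)%N)) mulr1.
  elim: u {Uu S0} hf => [|c u IH] hf; first by exists 0%N.
  have [|N hN] := IH; first by move=> d du; apply: hf; rewrite inE du orbT.
  have [e [k [l [p [hp hl Ed Ef]]]]] := hf c (mem_head _ _).
  have El : l = e by apply: dhomog_uniq hl (Xe e); rewrite expf_neq0 ?mpolyX_neq0.
  exists (maxn N e) => d; rewrite inE => /orP [/eqP ->|du].
    apply: (stepN c e _ p); rewrite ?leq_maxr //; split=> //.
    by exists k => //; rewrite Ed El; lia.
  have [q hq] := hN d du.
  by apply: (stepN d N _ q) => //; rewrite leq_maxl.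
have /choice [g hg] : forall d, exists q : {mpoly K[n.+1]}, d \in u ->
    [/\ exists2 k, q \is k.-homog & d + N%:Z = k%:Z & f d = q%:F / hcoord a ^+ N].
  move=> d; case: (boolP (d \in u)) => [/hN [p hp]|_]; last by exists 0.
  by exists p.
have Sg : \sum_(d <- u) g d = 0.
  apply/eqP; rewrite -tofrac_eq0 rmorph_sum /=.
  have : (\sum_(d <- u) (g d)%:F) / hcoord a ^+ N == 0.
    apply/eqP; rewrite big_distrl /= -[RHS]S0; apply: eq_big_seq => d du.
    by have [_ ->] := hg d du.
  by rewrite mulf_eq0 invr_eq0 (negPf (XF N)) orbF.
move=> d du; have [[k hk Ek] ->] := hg d du.
have : pihomog mdeg k (\sum_(d <- u) g d) = 0 by rewrite Sg raddf0.
rewrite raddf_sum (bigD1_seq d) //= pihomog_dE // big1_seq ?addr0.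
  by move=> ->; rewrite rmorph0 mul0r.
move=> c /andP [cd cu]; have [[k' hk' Ek'] _] := hg c cu.
by apply: pihomog_ne0 hk'; apply: contraNneq cd => Ekk; apply/eqP; move: Ek Ek'; rewrite Ekk; lia.
Qed.

End ProjectiveSpace.

(** * Vector bundles *)

Section Bundles.
Variables (K : fieldType) (n : nat).
Local Notation F := (homfrac K n).
Local Notation x := (@hcoord K n).

(* A vector bundle of rank r, trivial on each standard chart.  With local
   frames e(a) over U_a, the transition matrices are normalized by
     e(a)_i = \sum_l transition a b i l * e(b)_l   over U_a \cap U_b. *)
Record vbundle (r : nat) := VBundle {
  transition : 'I_n.+1 -> 'I_n.+1 -> 'M[F]_r;
  transition_regular : forall a b i l,
    twist_section 0 ('X_a * 'X_b) (transition a b i l);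
  transition_id : forall a, transition a a = 1%:M;
  transition_comp : forall a b c, transition a b *m transition b c = transition a c
}.

(* Tangent bundle.  The frame over U_a consists of the coordinate vector
   fields d/d(x_j/x_a), j != a, numbered by [lift a]; on the field of degree
   zero fractions d/d(x_j/x_a) acts as x_a * d/dx_j.  The transition matrices
   are the Jacobian matrices of the coordinate changes. *)
Definition jacobian (a b : 'I_n.+1) : 'M[F]_n :=
  \matrix_(j, l) (x a * pderiv (lift a j) (x (lift b l) / x b)).

Local Notation jac := (jac_entry x).

Lemma jacobianE a b j l : jacobian a b j l = jac a b (lift a j) (lift b l).
Proof.
have xb0 := hcoord_neq0 K b.
rewrite mxE /hcoord pderiv_frac ?mpolyX_neq0 // !mderivX -!/(hcoord _ _).
have dX (c d : 'I_n.+1) :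
    (U_(d)%MM c)%:R *: 'X_[(U_(d) - U_(c))%MM] = (c == d)%:R :> {mpoly K[n.+1]}.
  rewrite mnm1E eq_sym; case: eqP => [->|_]; last by rewrite scale0r.
  have -> : (U_(d) - U_(d))%MM = 0%MM :> 'X_{1..n.+1}.
    by apply/mnmP => i; rewrite mnmBE mnm0E subnn.
  by rewrite scale1r mpolyX0.
by rewrite !dX rmorphB !rmorphM !rmorph_nat /= /jac_entry -jacobian_aux ?hcoord_neq0.
Qed.

Fact jacobian_regular a b i l : twist_section 0 ('X_a * 'X_b) (jacobian a b i l).
Proof.
rewrite jacobianE /jac_entry; set j := lift a i; set k := lift b l.
have hX (c : 'I_n.+1) : ('X_c : {mpoly K[n.+1]}) \is 1.-homog.
  by rewrite dhomogX /= mdeg1.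
pose p : {mpoly K[n.+1]} :=
  'X_a * 'X_a * ((j == k)%:R *: ('X_a * 'X_b) - (j == b)%:R *: ('X_a * 'X_k)).
exists 2%N, 4%N, 4%N, p; split.
- have h2 c d : ('X_c * 'X_d : {mpoly K[n.+1]}) \is 2.-homog.
    exact: (@dhomogM _ _ _ 1 _ 1 _).
  by apply: (@dhomogM _ _ _ 2 _ 2 _) => //; rewrite rpredB // dhomogZ.
- by rewrite exprMn !expr2; do ?[apply: (@dhomogM _ _ _ 2 _ 2 _) | apply: (@dhomogM _ _ _ 1 _ 1 _)].
- by [].
- rewrite /p -!mul_mpolyC !(rmorphM, rmorphB) /= !mpolyC_nat !rmorph_nat.
  rewrite -!/(hcoord _ _).
  by apply: jacobian_regular_aux; apply: hcoord_neq0.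
Qed.

Fact jacobian_id a : jacobian a a = 1%:M.
Proof.
apply/matrixP => j l; rewrite jacobianE jac_entry_id ?mxE //.
exact: hcoord_neq0.
Qed.

Fact jacobian_comp a b c : jacobian a b *m jacobian b c = jacobian a c.
Proof.
apply/matrixP => j l; rewrite mxE jacobianE -(jac_entry_comp (@hcoord_neq0 K n) a b).
by apply: eq_bigr => i _; rewrite !jacobianE.
Qed.

Definition tangent_bundle : vbundle n :=
  VBundle jacobian_regular jacobian_id jacobian_comp.

Section Trivial.
Variable m : nat.

Fact trivial_regular (a b : 'I_n.+1) (i l : 'I_m) :
  twist_section 0 ('X_a * 'X_b) ((1%:M : 'M[F]_m) i l).
Proof.
rewrite mxE -(rmorph_nat (@FracField.tofrac _)) -mpolyC_nat.
exact: twist_sectionC.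
Qed.

Fact trivial_id (a : 'I_n.+1) : 1%:M = 1%:M :> 'M[F]_m.
Proof. by []. Qed.

Fact trivial_comp (a b c : 'I_n.+1) : 1%:M *m 1%:M = 1%:M :> 'M[F]_m.
Proof. exact: mul1mx. Qed.

Definition trivial_bundle : vbundle m :=
  @VBundle m (fun _ _ => 1%:M) trivial_regular trivial_id trivial_comp.

End Trivial.

Section Tensor.
Variables (r1 r2 : nat) (E1 : vbundle r1) (E2 : vbundle r2).

Fact tensor_regular a b i l :
  twist_section 0 ('X_a * 'X_b) ((transition E1 a b *t transition E2 a b) i l).
Proof. by rewrite mxE -[0]addr0; apply: twist_sectionM; apply: transition_regular. Qed.

Fact tensor_id a : transition E1 a a *t transition E2 a a = 1%:M.
Proof.
rewrite !transition_id; apply/matrixP => i j.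
case: (mxtens_indexP i) => {i} i1 i2; case: (mxtens_indexP j) => {j} j1 j2.
rewrite tensmxE !mxE -natrM mulnb; congr (nat_of_bool _)%:R.
by rewrite (can_eq (@mxtens_indexK _ _)).
Qed.

Fact tensor_comp a b c :
  (transition E1 a b *t transition E2 a b) *m (transition E1 b c *t transition E2 b c) =
  transition E1 a c *t transition E2 a c.
Proof. by rewrite tensmx_mul !transition_comp. Qed.

Definition tensor_bundle : vbundle (r1 * r2) :=
  VBundle tensor_regular tensor_id tensor_comp.

End Tensor.
End Bundles.

(** * The Cox ring of P(E) *)

Section CoxRing.
Variables (K : fieldType) (n r : nat) (E : vbundle K n r).
Local Notation F := (homfrac K n).

(* Over U_a the algebra Sym E is the polynomial algebra on the frame e(a).  A
   family holds one polynomial per chart, in the frame of that chart and with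
   coefficients in the whole field F; [is_section] bounds the coefficients and
   makes the polynomials agree on overlaps. *)
Definition sym_family := {ffun 'I_n.+1 -> {mpoly F[r]}}.

Definition frame_change (a b : 'I_n.+1) (p : {mpoly F[r]}) : {mpoly F[r]} :=
  p \mPo [tuple \sum_l transition E a b i l *: 'X_l | i < r].

(* H^0(P^n, Sym^k(E) (x) O(d)) *)
Definition is_section (k : nat) (d : int) (s : sym_family) : Prop :=
  [/\ forall a, s a \is k.-homog,
      forall a w, twist_section d 'X_a (s a)@_w
    & forall a b, frame_change a b (s a) = s b].

(* The direct sum of the H^0(P^n, Sym^k(E) (x) O(d)) over k in nat and d in
   int, realized inside the product ring of families; Pic(P^n) is identified
   with int through the O(d).  [is_section_direct] below shows that the sum
   is direct. *)
Definition cox_elem (s : sym_family) : Prop :=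
  exists (u : seq (nat * int)) (t : nat * int -> sym_family),
    [/\ uniq u, forall kd, kd \in u -> is_section kd.1 kd.2 (t kd)
      & s = \sum_(kd <- u) t kd].

Lemma is_section0 k d : is_section k d 0.
Proof.
split=> [a|a w|a b]; rewrite !ffunE ?rpred0 ?mcoeff0 //.
- exact: twist_section0.
- exact: comp_mpoly0.
Qed.

Lemma is_sectionC (c : K) : is_section 0 0 [ffun => (c%:MP%:F)%:MP].
Proof.
split=> [a|a w|a b]; rewrite !ffunE.
- by rewrite -[_%:MP]mulr1 mul_mpolyC dhomogZ // dhomog1.
- rewrite mcoeffC; case: eqP => _; rewrite ?mulr1 ?mulr0.
    exact: twist_sectionC.
  exact: twist_section0.
- exact: comp_mpolyC.
Qed.

Lemma is_sectionD k d s1 s2 :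
  is_section k d s1 -> is_section k d s2 -> is_section k d (s1 + s2).
Proof.
move=> [h1 c1 t1] [h2 c2 t2]; split=> [a|a w|a b]; rewrite !ffunE.
- exact: rpredD.
- by rewrite mcoeffD; apply: twist_sectionD => //; apply: mpolyX_neq0.
- by rewrite /frame_change comp_mpolyD -(t1 a b) -(t2 a b).
Qed.

Lemma is_sectionN k d s : is_section k d s -> is_section k d (- s).
Proof.
move=> [h c t]; split=> [a|a w|a b]; rewrite !ffunE.
- by rewrite rpredN.
- by rewrite mcoeffN; apply: twist_sectionN.
- by rewrite /frame_change comp_mpolyN -(t a b).
Qed.

Lemma is_sectionM k1 d1 s1 k2 d2 s2 :
  is_section k1 d1 s1 -> is_section k2 d2 s2 ->
  is_section (k1 + k2) (d1 + d2) (s1 * s2).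
Proof.
move=> [h1 c1 t1] [h2 c2 t2]; split=> [a|a w|a b]; rewrite !ffunE.
- exact: dhomogM.
- rewrite mcoeffM; apply: twist_section_sum => i _.
  by apply: twist_sectionM.
- by rewrite /frame_change rmorphM /= -(t1 a b) -(t2 a b).
Qed.

Lemma cox_elem_section k d s : is_section k d s -> cox_elem s.
Proof.
move=> h; exists [:: (k, d)], (fun=> s).
by split=> // [kd|]; rewrite ?big_seq1 // inE => /eqP ->.
Qed.

Lemma cox_elem0 : cox_elem 0.
Proof. exact: (cox_elem_section (is_section0 0 0)). Qed.

Lemma cox_elemD1 s k d v : cox_elem s -> is_section k d v -> cox_elem (s + v).
Proof.
move=> [u [t [Uu ht ->]]] hv.
case: (boolP ((k, d) \in u)) => [uin|unin].
- exists u, (fun c => if c == (k, d) then t c + v else t c); split=> //.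
    move=> kd kdu; case: eqP => [E0|_]; last exact: ht.
    by apply: is_sectionD; [apply: ht | rewrite E0].
  rewrite (bigD1_seq (k, d)) //= [RHS](bigD1_seq (k, d)) //= eqxx addrAC.
  by congr (_ + _); apply: eq_bigr => c /negPf ->.
- exists ((k, d) :: u), (fun c => if c == (k, d) then v else t c); split.
  + by rewrite /= unin.
  + move=> kd; rewrite inE; case: eqP => [-> //|_ /=]; exact: ht.
  + rewrite big_cons eqxx addrC; congr (_ + _).
    apply: eq_big_seq => c cu; case: eqP => // E0.
    by rewrite E0 (negPf unin) in cu.
Qed.

Lemma cox_elemD s1 s2 : cox_elem s1 -> cox_elem s2 -> cox_elem (s1 + s2).
Proof.
move=> h1 [u [t [_ ht ->]]]; elim: u ht s1 h1 => [|c u IH] ht s1 h1.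
  by rewrite big_nil addr0.
rewrite big_cons addrA; apply: IH.
  by move=> kd kdu; apply: ht; rewrite inE kdu orbT.
by apply: cox_elemD1 h1 (ht _ _); rewrite mem_head.
Qed.

Lemma cox_elem_sum (I : eqType) (u : seq I) (f : I -> sym_family) :
  (forall i, i \in u -> cox_elem (f i)) -> cox_elem (\sum_(i <- u) f i).
Proof.
by move=> h; rewrite big_seq; apply: big_ind => //;
  [apply: cox_elem0 | apply: cox_elemD].
Qed.

Lemma cox_elemN s : cox_elem s -> cox_elem (- s).
Proof.
move=> [u [t [_ ht ->]]]; rewrite -sumrN; apply: cox_elem_sum => i iu.
exact: cox_elem_section (is_sectionN (ht i iu)).
Qed.

Lemma cox_elemM s1 s2 : cox_elem s1 -> cox_elem s2 -> cox_elem (s1 * s2).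
Proof.
move=> [u1 [t1 [_ h1 ->]]] [u2 [t2 [_ h2 ->]]].
rewrite big_distrl; apply: cox_elem_sum => i iu /=.
rewrite big_distrr; apply: cox_elem_sum => j ju /=.
exact: cox_elem_section (is_sectionM (h1 i iu) (h2 j ju)).
Qed.

Lemma cox_elemC (c : K) : cox_elem [ffun => (c%:MP%:F)%:MP].
Proof. exact: cox_elem_section (is_sectionC c). Qed.

Lemma is_section_direct (u : seq (nat * int)) (t : nat * int -> sym_family) :
  uniq u -> (forall kd, kd \in u -> is_section kd.1 kd.2 (t kd)) ->
  \sum_(kd <- u) t kd = 0 -> forall kd, kd \in u -> t kd = 0.
Proof.
move=> Uu ht S0 [k d] kdu; apply/ffunP => a; rewrite [RHS]ffunE.
apply/mpolyP => w; rewrite mcoeff0.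
have [hk _ _] := ht _ kdu.
have [Ew|Ew] := eqVneq (mdeg w) k; last exact: dhomog_nemf_coeff (hk a) Ew.
pose v := [seq c.2 | c <- u & c.1 == k].
have Uv : uniq v.
  rewrite map_inj_in_uniq ?filter_uniq // => -[k1 d1] [k2 d2].
  by rewrite !mem_filter /= => /andP [/eqP -> _] /andP [/eqP -> _] ->.
apply: (twist_section_direct (a := a) (u := v) (f := fun d => (t (k, d) a)@_w)) => //.
- move=> c /mapP [[k1 d1]]; rewrite mem_filter /= => /andP [/eqP -> cu] ->.
  by have [_ hc _] := ht _ cu; apply: hc.
- have := congr1 (fun s : sym_family => (s a)@_w) S0.
  rewrite sum_ffunE ffunE mcoeff0 raddf_sum /= => S1; rewrite -[RHS]S1.
  rewrite /v big_map big_filter [RHS](bigID (fun c => c.1 == k)) /=.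
  rewrite [X in _ = _ + X]big1_seq ?addr0 => [|c /andP [ck cu]].
    by apply: eq_bigr => -[k1 d1] /= /eqP ->.
  have [hc _ _] := ht _ cu.
  apply: (dhomog_nemf_coeff (hc a)); apply: contraNneq ck => <-; exact/eqP.
- by apply/mapP; exists (k, d) => //; rewrite mem_filter /= eqxx.
Qed.

Definition cox_pred : {pred sym_family} := fun s => `[< cox_elem s >].

Fact cox_subring : subring_closed cox_pred.
Proof.
split=> [|s1 s2 /asboolP h1 /asboolP h2|s1 s2 /asboolP h1 /asboolP h2]; apply/asboolP.
- rewrite (_ : 1 = [ffun => ((1 : K)%:MP%:F)%:MP]); first exact: cox_elemC.
  apply/ffunP => a; rewrite [RHS]ffunE [LHS]ffunE.
  rewrite [(1 : K)%:MP](mpolyC1 n.+1 K) (rmorph1 (@FracField.tofrac _)).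
  exact: esym (mpolyC1 r F).
- exact: cox_elemD h1 (cox_elemN h2).
- exact: cox_elemM.
Qed.

Record cox_ring := CoxRing { cox_val : sym_family; _ : cox_val \in cox_pred }.

HB.instance Definition _ := [isSub for cox_val].
HB.instance Definition _ := [Choice of cox_ring by <:].
HB.instance Definition _ :=
  GRing.SubChoice_isSubPzRing.Build sym_family cox_pred cox_ring cox_subring.

Fact cox_mulC : commutative (@GRing.mul cox_ring).
Proof.
move=> s t; apply: val_inj; rewrite !rmorphM /=.
by apply/ffunP => a; rewrite !ffunE mulrC.
Qed.

HB.instance Definition _ := GRing.PzSemiRing_hasCommutativeMul.Build cox_ring cox_mulC.

Definition cox_const (c : K) : cox_ring := CoxRing (introT (asboolP _) (cox_elemC c)).

End CoxRing.

(** * The quotient presentation *)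

Section Presentation.
Variables (K : fieldType) (m n : nat).

(* K[x_j, Y_ij]: the first n.+1 variables are the x_j, the remaining
   m * n.+1 ones the Y_ij. *)
Definition xY_poly := {mpoly K[n.+1 + m * n.+1]}.

Definition var_x (j : 'I_n.+1) : xY_poly := 'X_(lshift _ j).
Definition var_Y (i : 'I_m) (j : 'I_n.+1) : xY_poly :=
  'X_(rshift _ (mxtens_index (i, j))).

Definition incidence_poly (i : 'I_m) : xY_poly :=
  \sum_(j < n.+1) var_x j * var_Y i j.

Definition incidence_ideal : {pred xY_poly} := fun p =>
  `[< exists c : 'I_m -> xY_poly, p = \sum_i c i * incidence_poly i >].

Fact incidence_ideal_closed : idealr_closed incidence_ideal.
Proof.
split=> [||p q s /asboolP [c ->] /asboolP [c' ->]].
- by apply/asboolP; exists (fun=> 0); rewrite big1 // => i _; rewrite mul0r.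
- apply/asboolP => -[c] /(congr1 (meval (fun=> 0))) /eqP.
  rewrite meval1 raddf_sum big1 ?oner_eq0 //= => i _.
  rewrite mevalM /incidence_poly raddf_sum big1 ?mulr0 //= => j _.
  by rewrite mevalM !mevalXU mulr0.
- apply/asboolP; exists (fun i => p * c i + c' i).
  rewrite big_distrr -big_split /=; apply: eq_bigr => i _.
  by rewrite mulrDl mulrA.
Qed.

HB.instance Definition _ := isIdealr.Build xY_poly incidence_ideal
  incidence_ideal_closed.

Definition presented_ring := {ideal_quot (incidence_ideal : idealr xY_poly)}.

HB.instance Definition _ := GRing.ComNzRing.on presented_ring.

Definition presented_const (c : K) : presented_ring := \pi_presented_ring (c%:MP).

End Presentation.

(* Main.v *)
Require Import Defs.
From HB Require Import structures.
From mathcomp Require Import all_boot all_order all_algebra.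
From mathcomp Require Import ring zify boolp mpoly mxtens.

Set Implicit Arguments.
Unset Strict Implicit.
Unset Printing Implicit Defensive.

Import GRing.Theory.
Local Open Scope ring_scope.
Local Open Scope quotient_scope.

(* Over U_a the tangent bundle has the frame x_a d/dx_l, l != a, and Y_ij is
   the section d/dx_j (x) e_i of T(-1) (x) K^m; the incidence relations are the
   Euler relation.  The polynomials f_i = \sum_j x_j Y_ij have pairwise coprime
   initial monomials x_(i+1) Y_(i,i+1), i < m, so the monomials divisible by
   none of them span a complement N of the ideal, and reading off leading terms
   shows that N embeds into the sections over any single chart.

   A global section is p / x_0^e over U_0 and q / x_n^f over U_n with p, q in
   N.  As m < n, neither x_0 nor x_n occurs in an initial monomial, so
   p x_n^f - q x_0^e still lies in N, hence vanishes, and x_0^e divides p. *)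

(** * Field identities, induction on ring generators, leading coefficients *)

Section PartialCoef.
Variables (F : fieldType) (s t u v w : F).

Lemma partial_coef_frac : u != 0 ->
  (s - t * (v / u)) / u = (s * u - t * v) / (u * u).
Proof. by move=> u0; field. Qed.

Lemma partial_coef_split :
  w * ((s - t * (v / u)) / u) = w * s / u - w * t * (v / u / u).
Proof. by ring. Qed.

End PartialCoef.

Lemma mpoly_ring_ind (R : nzRingType) (N : nat) (P : {mpoly R[N]} -> Prop) :
  (forall c, P c%:MP) -> (forall i, P 'X_i) ->
  (forall p q, P p -> P q -> P (p + q)) ->
  (forall p q, P p -> P q -> P (p * q)) -> forall p, P p.
Proof.
move=> PC PX PD PM; elim/mpolyind => [|c w p _ _ Pp].
  by rewrite -mpolyC0; exact: PC.
apply: (PD) => //; rewrite -mul_mpolyC; apply: (PM) => //; rewrite mpolyXE_id.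
have P1 : P 1 by rewrite -mpolyC1; exact: PC.
elim/big_ind: _ => [||i _]; [exact: P1 | exact: PM |].
elim: (w i) => [|k IH]; first by rewrite expr0.
by rewrite exprS; apply: PM.
Qed.

(** The coefficient [c] may vanish, so [k] only bounds the degree; in this form the relation is
    multiplicative over any ring. *)
Definition leads (R : nzRingType) (k : nat) (c : R) (p : {poly R}) :=
  (size p <= k.+1)%N /\ p`_k = c.

Lemma leadsCXn (R : nzRingType) k (c : R) : leads k c (c%:P * 'X^k).
Proof.
split; last by rewrite coefCM coefXn eqxx mulr1.
by rewrite mul_polyC (leq_trans (size_scale_leq _ _)) // size_polyXn.
Qed.

(** In coefficient [k + l] of the product only the index [k] survives: a smaller index asks for a
    coefficient of [q] beyond [l], a larger one for a coefficient of [p] beyond [k]. *)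
Lemma leadsM (R : nzRingType) k l (c d : R) p q :
  leads k c p -> leads l d q -> leads (k + l) (c * d) (p * q).
Proof.
move=> [sp <-] [sq <-]; split.
  by apply: leq_trans (size_polyMleq _ _) _; lia.
rewrite coefM (bigD1 (inord k)) //= inordK ?ltnS ?leq_addr // addKn.
rewrite big1 ?addr0 // => -[i /= lti]; rewrite -val_eqE /= inordK ?ltnS ?leq_addr //.
move=> nik; case: (ltngtP i k) nik => // ik _.
  by rewrite [q`__]nth_default ?mulr0 //; apply: leq_trans sq _; lia.
by rewrite [p`__]nth_default ?mul0r //; apply: leq_trans sp _.
Qed.

(** * The sections x_j and Y_ij in the charts *)

Section Charts.
Variables (K : fieldType) (m n : nat).
Local Notation F := (homfrac K n).
Local Notation x := (@hcoord K n).
Local Notation jac := (jac_entry x).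
Local Notation TKm := (tensor_bundle (tangent_bundle K n) (trivial_bundle K n m)).
Local Notation xY := (xY_poly K m n).

Definition frame_var (l : 'I_n) (i : 'I_m) : {mpoly F[n * m]} :=
  'X_(mxtens_index (l, i)).

(* The section d/dx_j (x) e_i of T(-1) (x) K^m, written in the frame over U_a:
   x_0 d/dx_j = \sum_l jac 0 a j l * x_a d/dx_l, where l != a suffices by the
   Euler relation. *)
Definition partial_section (a : 'I_n.+1) (i : 'I_m) (j : 'I_n.+1) : {mpoly F[n * m]} :=
  \sum_l ((x ord0)^-1 * jac ord0 a j (lift a l)) *: frame_var l i.

Definition chart_var (a : 'I_n.+1) (v : 'I_(n.+1 + m * n.+1)) : {mpoly F[n * m]} :=
  match split v with
  | inl j => (x j)%:MP
  | inr t => partial_section a (mxtens_unindex t).1 (mxtens_unindex t).2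
  end.

Definition scalar_incl : K -> {mpoly F[n * m]} :=
  @mpolyC _ F \o (@FracField.tofrac _ \o @mpolyC n.+1 K).

HB.instance Definition _ := GRing.RMorphism.on scalar_incl.

Definition chart_map (a : 'I_n.+1) : xY -> {mpoly F[n * m]} :=
  mmap scalar_incl (chart_var a).

HB.instance Definition _ a := GRing.RMorphism.on (chart_map a).

Lemma chart_mapD a p q : chart_map a (p + q) = chart_map a p + chart_map a q.
Proof. exact: rmorphD. Qed.

Lemma chart_mapB a p q : chart_map a (p - q) = chart_map a p - chart_map a q.
Proof. exact: rmorphB. Qed.

Lemma chart_mapM a p q : chart_map a (p * q) = chart_map a p * chart_map a q.
Proof. exact: rmorphM. Qed.

Lemma chart_mapC a (c : K) : chart_map a c%:MP = (c%:MP%:F)%:MP.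
Proof. by rewrite /chart_map mmapC. Qed.

Lemma chart_map_x a j : chart_map a (var_x K m j) = (x j)%:MP.
Proof. by rewrite /chart_map mmapX mmap1U /chart_var (unsplitK (inl j)). Qed.

Lemma chart_map_Y a i j : chart_map a (var_Y K i j) = partial_section a i j.
Proof.
by rewrite /chart_map mmapX mmap1U /chart_var (unsplitK (inr _)) mxtens_indexK.
Qed.

Lemma xY_ind (P : xY -> Prop) :
  (forall c, P c%:MP) -> (forall j, P (var_x K m j)) ->
  (forall i j, P (var_Y K i j)) ->
  (forall p q, P p -> P q -> P (p + q)) ->
  (forall p q, P p -> P q -> P (p * q)) -> forall p, P p.
Proof.
move=> PC Px PY PD PM; apply: mpoly_ring_ind => // v.
rewrite -(splitK v); case: (split v) => [j|t] /=; first exact: Px.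
by case: (mxtens_indexP t) => i j; apply: PY.
Qed.

Lemma xY_rmorph_eq (S : nzRingType) (f g : {rmorphism xY -> S}) :
  (forall c, f c%:MP = g c%:MP) -> (forall j, f (var_x K m j) = g (var_x K m j)) ->
  (forall i j, f (var_Y K i j) = g (var_Y K i j)) -> f =1 g.
Proof.
move=> fC fx fY; apply: xY_ind => // p q Ep Eq; first by rewrite !rmorphD Ep Eq.
by rewrite !rmorphM Ep Eq.
Qed.

(** The factor [x_0^-1] cancels the [x_0] of the Jacobian entry, so that only powers of [x_a] remain
    in the denominator. *)
Lemma jac_coefE a (j l : 'I_n.+1) : (x ord0)^-1 * jac ord0 a j l =
  ((j == l)%:R - (j == a)%:R * (x l / x a)) / x a.
Proof. by rewrite /jac_entry !mulrA mulVf ?hcoord_neq0 // mul1r mulrC. Qed.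

Lemma frame_changeE a b p : frame_change TKm a b p =
  p \mPo [tuple \sum_l transition TKm a b i l *: 'X_l | i < n * m].
Proof. by []. Qed.

HB.instance Definition _ a b := GRing.RMorphism.copy (frame_change TKm a b)
  (@comp_mpoly _ _ _ [tuple \sum_l transition TKm a b i l *: 'X_l | i < n * m]).

(** The transition matrix of the factor [K^m] is the identity, so the Kronecker product keeps the
    index [i] and acts on [l] by the Jacobian. *)
Lemma frame_change_var a b l i : frame_change TKm a b (frame_var l i) =
  \sum_k jac a b (lift a l) (lift b k) *: frame_var k i.
Proof.
rewrite frame_changeE /frame_var comp_mpolyXU -tnth_nth tnth_mktuple.
rewrite (reindex (@mxtens_index n m)) /=; last first.
  by exists (@mxtens_unindex n m) => ? _; rewrite (mxtens_indexK, mxtens_unindexK).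
transitivity (\sum_k \sum_i' transition TKm a b (mxtens_index (l, i))
    (mxtens_index (k, i')) *: frame_var k i').
  by rewrite pair_bigA; apply: eq_bigr => -[k i'] _.
apply: eq_bigr => k _.
rewrite (bigD1 i) //= big1 ?addr0 => [|i' ne].
  by rewrite tensmxE [X in _ * X]mxE eqxx mulr1 jacobianE.
by rewrite tensmxE [X in _ * X]mxE eq_sym (negPf ne) mulr0 scale0r.
Qed.

(** This is the cocycle identity [jac_entry_comp] for the charts 0, [a], [b]; it holds for every row
    [j], also for the row 0 that has no frame vector over [U_0]. *)
Lemma frame_change_partial a b i j :
  frame_change TKm a b (partial_section a i j) = partial_section b i j.
Proof.
rewrite /partial_section frame_changeE raddf_sum /=.
rewrite (eq_bigr (fun l => \sum_k ((x ord0)^-1 * (jac ord0 a j (lift a l) *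
   jac a b (lift a l) (lift b k))) *: frame_var k i)); last first.
  move=> l _; rewrite comp_mpolyZ -frame_changeE frame_change_var scaler_sumr.
  by apply: eq_bigr => k _; rewrite scalerA -mulrA.
rewrite exchange_big; apply: eq_bigr => k _ /=.
by rewrite -scaler_suml -mulr_sumr jac_entry_comp //; apply: hcoord_neq0.
Qed.

Lemma frame_change_chart_map a b p :
  frame_change TKm a b (chart_map a p) = chart_map b p.
Proof.
apply: (@xY_rmorph_eq _ (frame_change TKm a b \o chart_map a) (chart_map b))
  => [c|j|i j] /=.
- by rewrite !chart_mapC frame_changeE comp_mpolyC.
- by rewrite !chart_map_x frame_changeE comp_mpolyC.
- by rewrite !chart_map_Y frame_change_partial.
Qed.

Lemma partial_section_regular a i j w :
  twist_section (-1) 'X_a (partial_section a i j)@_w.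
Proof.
rewrite raddf_sum /=; apply: twist_section_sum => l _.
rewrite mcoeffZ mcoeffX; case: eqP => _; last by rewrite mulr0; apply: twist_section0.
rewrite mulr1 jac_coefE.
have hX (c : 'I_n.+1) : ('X_c : {mpoly K[n.+1]}) \is 1.-homog.
  by rewrite dhomogX /= mdeg1.
(* Over the common denominator [x_a^2] the numerator is linear, and 1 - 2 = -1. *)
exists 2%N, 1%N, 2%N,
  ((j == lift a l)%:R *: 'X_a - (j == a)%:R *: 'X_(lift a l)); split=> //.
- by rewrite rpredB // dhomogZ.
- by rewrite expr2; apply: (@dhomogM _ _ _ 1 _ 1).
- rewrite -!mul_mpolyC !(rmorphM, rmorphB) /= !mpolyC_nat !rmorph_nat.
  rewrite -!/(hcoord _ _) expr2.
  exact: partial_coef_frac (hcoord_neq0 K a).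
Qed.

Definition chart_family (p : xY) : sym_family K n (n * m) :=
  [ffun a => chart_map a p].

Lemma chart_familyE p a : chart_family p a = chart_map a p.
Proof. exact: ffunE. Qed.

Lemma chart_family_is_zmod_morphism : zmod_morphism chart_family.
Proof. by move=> p q; apply/ffunP => a; rewrite !ffunE rmorphB. Qed.

Lemma chart_family_is_monoid_morphism : monoid_morphism chart_family.
Proof.
split=> [|p q]; apply/ffunP => a; first by rewrite [LHS]ffunE rmorph1 [RHS]ffunE.
by rewrite [LHS]ffunE chart_mapM [RHS]ffunE [X in _ = X * _]ffunE [X in _ = _ * X]ffunE.
Qed.

HB.instance Definition _ :=
  GRing.isZmodMorphism.Build _ _ chart_family chart_family_is_zmod_morphism.
HB.instance Definition _ :=
  GRing.isMonoidMorphism.Build _ _ chart_family chart_family_is_monoid_morphism.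

Lemma chart_familyC c : chart_family c%:MP = [ffun => (c%:MP%:F)%:MP].
Proof. by apply/ffunP => a; rewrite !ffunE chart_mapC. Qed.

Lemma is_section_x j : is_section TKm 0 1 (chart_family (var_x K m j)).
Proof.
split=> [a|a w|a b]; rewrite !ffunE.
- by rewrite chart_map_x -[_%:MP]mulr1 mul_mpolyC dhomogZ // dhomog1.
- rewrite chart_map_x mcoeffC; case: eqP => _.
    2: by rewrite mulr0; apply: twist_section0.
  exists 0%N, 1%N, 0%N, 'X_j; rewrite !expr0 divr1 mulr1; split=> //.
    by rewrite dhomogX /= mdeg1.
  exact: dhomog1.
- exact: frame_change_chart_map.
Qed.

Lemma is_section_Y i j : is_section TKm 1 (-1) (chart_family (var_Y K i j)).
Proof.
split=> [a|a w|a b]; rewrite !ffunE.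
- rewrite chart_map_Y; apply: rpred_sum => l _; rewrite dhomogZ //.
  by rewrite dhomogX /= mdeg1.
- by rewrite chart_map_Y; apply: partial_section_regular.
- exact: frame_change_chart_map.
Qed.

Lemma cox_elem_chart_family p : cox_elem TKm (chart_family p).
Proof.
move: p; apply: xY_ind => [c|j|i j|p q|p q].
- by rewrite chart_familyC; apply: cox_elemC.
- exact: cox_elem_section (is_section_x j).
- exact: cox_elem_section (is_section_Y i j).
- by rewrite rmorphD; apply: cox_elemD.
- by rewrite rmorphM; apply: cox_elemM.
Qed.

(** Euler relation: at each frame vector the Kronecker deltas leave [x_l / x_a] minus [x_a] times
    [x_l / x_a^2]. *)
Lemma chart_map_incidence a i : chart_map a (incidence_poly K n i) = 0.
Proof.
rewrite /incidence_poly rmorph_sum /=.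
rewrite (eq_bigr (fun j => \sum_l (x j * ((x ord0)^-1 * jac ord0 a j (lift a l)))
  *: frame_var l i)); last first.
  move=> j _; rewrite chart_mapM chart_map_x chart_map_Y mul_mpolyC scaler_sumr.
  by apply: eq_bigr => l _; rewrite scalerA.
rewrite exchange_big big1 // => l _ /=; rewrite -scaler_suml.
rewrite (eq_bigr (fun j => x j * (j == lift a l)%:R / x a -
   x j * (j == a)%:R * (x (lift a l) / x a / x a))); last first.
  by move=> j _; rewrite jac_coefE partial_coef_split.
have pick t : \sum_j x j * (j == t)%:R = x t.
  rewrite (bigD1 t) //= eqxx mulr1 big1 ?addr0 // => k /negPf ->.
  by rewrite mulr0.
rewrite sumrB -!mulr_suml !pick [x a * _]mulrC divfK ?hcoord_neq0 // subrr.
by rewrite scale0r.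
Qed.

Lemma chart_map_ideal a (p : xY) : p \in @incidence_ideal K m n -> chart_map a p = 0.
Proof.
move=> /asboolP [c ->]; rewrite rmorph_sum big1 // => i _ /=.
by rewrite chart_mapM chart_map_incidence mulr0.
Qed.

End Charts.

(** * Normal forms modulo the incidence ideal *)

Section NormalForms.
Variables (K : fieldType) (m n : nat) (le_mn : (m <= n)%N).
Local Notation xY := (xY_poly K m n).
Local Notation mono := ('X_{1..n.+1 + m * n.+1}).

Definition idx_x (j : 'I_n.+1) : 'I_(n.+1 + m * n.+1) := lshift _ j.
Definition idx_Y (i : 'I_m) (j : 'I_n.+1) : 'I_(n.+1 + m * n.+1) :=
  rshift _ (mxtens_index (i, j)).

Lemma idx_x_eq j k : (idx_x j == idx_x k) = (j == k).
Proof. exact: (inj_eq (@lshift_inj _ _)). Qed.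

Lemma idx_Y_eq i j i' j' : (idx_Y i j == idx_Y i' j') = (i == i') && (j == j').
Proof.
by rewrite (inj_eq (@rshift_inj _ _)) (inj_eq (can_inj (@mxtens_indexK _ _))).
Qed.

Lemma idx_xY_eq j i k : (idx_x j == idx_Y i k) = false.
Proof. exact: eq_lrshift. Qed.

Lemma idx_Yx_eq j i k : (idx_Y i k == idx_x j) = false.
Proof. exact: eq_rlshift. Qed.

Definition idx_eq := (idx_x_eq, idx_Y_eq, idx_xY_eq, idx_Yx_eq).

Variant idx_spec : 'I_(n.+1 + m * n.+1) -> Type :=
  | IdxX j : idx_spec (idx_x j)
  | IdxY i j : idx_spec (idx_Y i j).

Lemma idxP v : idx_spec v.
Proof.
rewrite -(splitK v); case: (split v) => [j|t] /=; first exact: IdxX.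
by case: (mxtens_indexP t) => i j; apply: IdxY.
Qed.

(** The diagonal columns [i + 1] are pairwise distinct and avoid 0; when [m < n] they avoid [n] as
    well. *)
Definition diag_row (i : 'I_m) : 'I_n := widen_ord le_mn i.
Definition diag_col (i : 'I_m) : 'I_n.+1 := lift ord0 (diag_row i).

(* The monomials outside the initial ideal <x_(i+1) Y_(i,i+1) | i < m>. *)
Definition standard (w : mono) : bool :=
  [forall i, (w (idx_x (diag_col i)) == 0%N) || (w (idx_Y i (diag_col i)) == 0%N)].

Definition normal (p : xY) : Prop := forall w, w \in msupp p -> standard w.

Lemma normalP (p : xY) : normal p <-> forall w, ~~ standard w -> p@_w = 0.
Proof.
split=> np w.
  move=> sw; apply/eqP; rewrite mcoeff_eq0; apply: contra sw; exact: np.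
by rewrite mcoeff_msupp; apply: contraNT => /np ->.
Qed.

Lemma normal0 : normal 0.
Proof. by move=> w; rewrite msupp0. Qed.

Lemma normalD p q : normal p -> normal q -> normal (p + q).
Proof.
move=> /normalP np /normalP nq; apply/normalP => w sw.
by rewrite mcoeffD np ?nq ?addr0.
Qed.

Lemma normalZ c p : normal p -> normal (c *: p).
Proof.
by move=> /normalP np; apply/normalP => w sw; rewrite mcoeffZ np ?mulr0.
Qed.

Lemma normalB p q : normal p -> normal q -> normal (p - q).
Proof. by move=> np nq; rewrite -scaleN1r; apply/normalD/normalZ. Qed.

(** The test [standard] looks only at the exponents of the [x_j] in diagonal columns and of the
    diagonal [Y], none of which changes. *)
Lemma normalMx p j e : (forall i, j != diag_col i) -> normal p ->
  normal (p * var_x K m j ^+ e).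
Proof.
move=> nj np w; rewrite mpolyXn (perm_mem (msuppMX _ _)) => /mapP [u /np su ->].
apply/forallP => i; have := forallP su i.
by rewrite !mnmDE !mulmnE !mnm1E !idx_eq (negPf (nj i)) !mul0n !add0n.
Qed.

(** Termination measure of the reduction. It ignores the [x_j], since a reduction step may introduce
    an [x_j] from another diagonal column but never a new diagonal [Y]. *)
Definition diag_degree (w : mono) : nat := \sum_i w (idx_Y i (diag_col i)).

Lemma incidence_poly_in i : incidence_poly K n i \in @incidence_ideal K m n.
Proof.
apply/asboolP; exists (fun k => (k == i)%:R).
by rewrite (bigD1 i) //= eqxx mul1r big1 ?addr0 // => k /negPf ->; rewrite mul0r.
Qed.

Definition reducible (p : xY) : Prop :=
  exists2 q, normal q & p - q \in @incidence_ideal K m n.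

Lemma reducibleD p q : reducible p -> reducible q -> reducible (p + q).
Proof.
move=> [p' np Ip] [q' nq Iq]; exists (p' + q'); first exact: normalD.
by rewrite opprD addrACA rpredD.
Qed.

Lemma reducibleZ c p : reducible p -> reducible (c *: p).
Proof.
move=> [p' np Ip]; exists (c *: p'); first exact: normalZ.
by rewrite -scalerBr -mul_mpolyC idealMr.
Qed.

Lemma reducible_sum (I : Type) (r : seq I) (P : pred I) (f : I -> xY) :
  (forall i, P i -> reducible (f i)) -> reducible (\sum_(i <- r | P i) f i).
Proof.
move=> H; elim/big_ind: _ => //; last exact: reducibleD.
by exists 0; [apply: normal0 | rewrite subr0 rpred0].
Qed.

Lemma reducible_ideal p q : q \in @incidence_ideal K m n -> reducible p ->
  reducible (q + p).
Proof.
move=> Iq [p' np Ip]; exists p' => //.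
by rewrite -addrA rpredD.
Qed.

(* Trading x_(i+1) Y_(i,i+1) for - \sum_(j != i+1) x_j Y_(i,j) lowers
   the diagonal degree by one. *)
Lemma reducible_mono (w : mono) : reducible 'X_[w].
Proof.
have [d] := ubnP (diag_degree w); elim: d w => // d IH w.
rewrite ltnS => le_wd.
have [sw|] := boolP (standard w).
  exists 'X_[w]; last by rewrite subrr rpred0.
  by move=> u; rewrite msuppX inE => /eqP ->.
rewrite negb_forall => /existsP [i]; rewrite negb_or => /andP [wx wY].
pose u j : mono := (U_(idx_x j) + U_(idx_Y i j))%MM.
(* Both exponents are positive at the failing index [i], so this truncated subtraction is exact. *)
pose w' := (w - u (diag_col i))%MM.
have Ew : w = (w' + u (diag_col i))%MM.
  rewrite submK //; apply/mnm_lepP => v; rewrite mnmDE !mnm1E.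
  by case: (idxP v) => [j|k j]; rewrite !idx_eq ?addn0 ?add0n;
    case: eqP => [<-|_] //=; rewrite ?lt0n //; case: eqP => [<-|_] //; rewrite lt0n.
have Xu j v : 'X_[v + u j] = 'X_[v] * (var_x K m j * var_Y K i j) :> xY.
  by rewrite !mpolyXD.
have -> : 'X_[w] = 'X_[w'] * incidence_poly K n i +
    \sum_(j | j != diag_col i) (-1) *: 'X_[w' + u j] :> xY.
  rewrite /incidence_poly (bigD1 (diag_col i)) //= mulrDr -Xu -Ew -addrA.
  rewrite -scaler_sumr scaleN1r (eq_bigr _ (fun j _ => Xu j w')) -mulr_sumr.
  by rewrite subrr addr0.
apply: reducible_ideal; first by rewrite idealMr // incidence_poly_in.
apply: reducible_sum => j nj; apply/reducibleZ/IH; apply: leq_trans le_wd.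
have dD v1 v2 : diag_degree (v1 + v2) = (diag_degree v1 + diag_degree v2)%N.
  by rewrite -big_split; apply: eq_bigr => k _; rewrite mnmDE.
have du k : diag_degree (u k) = (k == diag_col i).
  rewrite /diag_degree (bigD1 i) //= big1 ?addn0 => [|i' ni].
    by rewrite mnmDE !mnm1E !idx_eq eqxx.
  by rewrite mnmDE !mnm1E !idx_eq eq_sym (negPf ni).
by rewrite Ew 2!(dD w') !du eqxx (negPf nj) addn0 addn1.
Qed.

Lemma reducible_all p : reducible p.
Proof.
by rewrite (mpolyE p); apply: reducible_sum => w _; apply/reducibleZ/reducible_mono.
Qed.

(** * Leading terms over [U_0] and injectivity on normal forms *)

Local Notation F := (homfrac K n).
Local Notation x := (@hcoord K n).
Local Notation FX := {mpoly F[n * m]}.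

(* The weight gives X_(l,i) the degree [l == i] in the new variable, so that
   the image of Y_(i,0) gets the leading term x_(i+1) X_(i,i); the factor
   - x_0^2 clears denominators. *)
Definition weight_var (t : 'I_(n * m)) : {poly FX} :=
  ((- x ord0 ^+ 2) *: 'X_t)%:P
    * 'X^((mxtens_unindex t).1 == diag_row (mxtens_unindex t).2).

Definition weight_incl : F -> {poly FX} := polyC \o @mpolyC _ F.
HB.instance Definition _ := GRing.RMorphism.on weight_incl.

Definition weight_map : FX -> {poly FX} := mmap weight_incl weight_var.
HB.instance Definition _ := GRing.RMorphism.on weight_map.

Definition weighted : xY -> {poly FX} := weight_map \o chart_map ord0.
HB.instance Definition _ := GRing.RMorphism.on weighted.

Lemma weight_mapC c : weight_map c%:MP = c%:MP%:P.
Proof. exact: mmapC. Qed.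

Lemma weight_mapZ c p : weight_map (c *: p) = c%:MP%:P * weight_map p.
Proof. by rewrite -mul_mpolyC rmorphM /= weight_mapC. Qed.

Lemma weight_frame_var l i : weight_map (frame_var K l i) =
  ((- x ord0 ^+ 2) *: frame_var K l i)%:P * 'X^(l == diag_row i).
Proof. by rewrite /weight_map mmapX mmap1U /weight_var mxtens_indexK. Qed.

Lemma weightedC c : weighted c%:MP = c%:MP%:F%:MP%:P.
Proof. by rewrite /weighted /= chart_mapC weight_mapC. Qed.

Lemma weightedM p q : weighted (p * q) = weighted p * weighted q.
Proof. exact: rmorphM. Qed.

Lemma weighted_x j : weighted (var_x K m j) = (x j)%:MP%:P.
Proof. by rewrite /weighted /= chart_map_x weight_mapC. Qed.

(** Over [U_0] this variable goes to [x_0^-1] times a single frame variable; the scaling by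
    [- x_0^2] turns the factor into [- x_0]. *)
Lemma weighted_Y i l : weighted (var_Y K i (lift ord0 l)) =
  (- (x ord0) *: frame_var K l i)%:P * 'X^(l == diag_row i).
Proof.
rewrite /weighted /= chart_map_Y /partial_section (bigD1 l) //= big1 ?addr0.
  rewrite jac_entry_id ?eqxx ?mulr1; last exact: hcoord_neq0.
  rewrite weight_mapZ weight_frame_var mulrA -polyCM mul_mpolyC scalerA.
  by rewrite mulrN expr2 mulKf ?hcoord_neq0.
move=> k nk; rewrite jac_entry_id; last exact: hcoord_neq0.
by rewrite eq_sym (negPf nk) mulr0 scale0r.
Qed.

(** By the Euler relation the image over [U_0] has coefficients [- x_(l+1) / x_0^2], whose sign and
    denominator the scaling removes. *)
Lemma weighted_Y0 i : weighted (var_Y K i ord0) =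
  \sum_l (x (lift ord0 l) *: frame_var K l i)%:P * 'X^(l == diag_row i).
Proof.
rewrite /weighted /= chart_map_Y /partial_section raddf_sum.
apply: eq_bigr => l _ /=.
rewrite jac_coefE eqxx (negPf (neq_lift _ _)) sub0r mul1r.
rewrite weight_mapZ weight_frame_var mulrA -polyCM mul_mpolyC scalerA.
by rewrite mulNr mulrNN expr2 mulrA !divfK ?hcoord_neq0.
Qed.

(** Each [Y_(i,j)] with [j != 0] contributes a factor [- x_0] to the leading coefficient, so this
    number governs both the sign and the extra power of [x_0]. *)
Definition off0_degree (w : mono) : nat :=
  \sum_(t | (mxtens_unindex t).2 != ord0 :> 'I_n.+1) w (rshift n.+1 t).

(** Exactly the [Y_(i,i+1)] and the [Y_(i,0)] have images of degree one in the new variable; all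
    other variables have degree zero. *)
Definition lead_weight (w : mono) : nat :=
  \sum_i (w (idx_Y i (diag_col i)) + w (idx_Y i ord0)).

(** Besides the [x_j] themselves, each [Y_(i,j)] with [j != 0] brings an [x_0] and each [Y_(i,0)]
    brings an [x_(i+1)]. *)
Definition lead_x (w : mono) : 'X_{1..n.+1} :=
  [multinom (w (idx_x j) + (if j == ord0 then off0_degree w else
     \sum_(i | j == diag_col i) w (idx_Y i ord0)))%N | j < n.+1].

(** The frame variable [X_(l,i)] comes from [Y_(i,l+1)] and, when [l = i], also from [Y_(i,0)]. *)
Definition lead_X (w : mono) : 'X_{1..n * m} :=
  [multinom (w (idx_Y (mxtens_unindex t).2 (lift ord0 (mxtens_unindex t).1)) +
     ((mxtens_unindex t).1 == diag_row (mxtens_unindex t).2) *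
       w (idx_Y (mxtens_unindex t).2 ord0))%N | t < n * m].

Lemma lead_XE w l i : lead_X w (mxtens_index (l, i)) =
  (w (idx_Y i (lift ord0 l)) + (l == diag_row i) * w (idx_Y i ord0))%N.
Proof. by rewrite [LHS]mnmE mxtens_indexK. Qed.

Lemma mnm_tensP (u v : 'X_{1..n * m}) :
  (forall l i, u (mxtens_index (l, i)) = v (mxtens_index (l, i))) -> u = v.
Proof. by move=> E; apply/mnmP => t; case: (mxtens_indexP t) => l i; apply: E. Qed.

Definition lead_coefw (w : mono) : FX :=
  (((-1) ^+ off0_degree w *: 'X_[lead_x w])%:F : F) *: 'X_[lead_X w].

Lemma off0_degreeD u v : off0_degree (u + v) = (off0_degree u + off0_degree v)%N.
Proof. by rewrite -big_split; apply: eq_bigr => t _; rewrite mnmDE. Qed.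

Lemma lead_weightD u v : lead_weight (u + v) = (lead_weight u + lead_weight v)%N.
Proof. by rewrite -big_split; apply: eq_bigr => t _; rewrite !mnmDE addnACA. Qed.

Lemma lead_xD u v : lead_x (u + v) = (lead_x u + lead_x v)%MM.
Proof.
apply/mnmP => j; rewrite mnmDE ![lead_x _ _]mnmE mnmDE addnACA; congr (_ + _)%N.
case: ifP => _; first exact: off0_degreeD.
by rewrite -big_split; apply: eq_bigr => i _; rewrite mnmDE.
Qed.

Lemma lead_XD u v : lead_X (u + v) = (lead_X u + lead_X v)%MM.
Proof.
by apply: mnm_tensP => l i; rewrite mnmDE !lead_XE !mnmDE mulnDr addnACA.
Qed.

Lemma lead_coefwD u v : lead_coefw (u + v) = lead_coefw u * lead_coefw v.
Proof.
rewrite /lead_coefw lead_XD lead_xD off0_degreeD !mpolyXD exprD.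
rewrite -scalerAl -scalerAr scalerA -rmorphM /=; congr (_%:F *: _).
by rewrite -scalerAl -scalerAr scalerA.
Qed.

Lemma off0_degree_x j : off0_degree U_(idx_x j) = 0%N.
Proof. by rewrite /off0_degree big1 // => t _; rewrite mnm1E eq_lrshift. Qed.

Lemma off0_degree_Y i j : off0_degree U_(idx_Y i j) = (j != ord0).
Proof.
rewrite /off0_degree big_mkcond (bigD1 (mxtens_index (i, j))) // big1 ?addn0.
  by rewrite mxtens_indexK mnm1E eqxx; case: ifP.
by move=> t nt; rewrite mnm1E (inj_eq (@rshift_inj _ _)) [_ == t]eq_sym (negPf nt)
  if_same.
Qed.

Lemma leads_x j : leads (lead_weight U_(idx_x j)) (lead_coefw U_(idx_x j))
  (weighted (var_x K m j)).
Proof.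
have -> : lead_weight U_(idx_x j) = 0%N.
  by apply: big1 => i _; rewrite !mnm1E !idx_eq.
have -> : lead_coefw U_(idx_x j) = (x j)%:MP.
  rewrite /lead_coefw off0_degree_x expr0 scale1r.
  have -> : lead_x U_(idx_x j) = U_(j)%MM.
    apply/mnmP => k; rewrite mnmE off0_degree_x !mnm1E idx_eq.
    by rewrite big1 ?if_same ?addn0 // => i _; rewrite mnm1E idx_eq.
  have -> : lead_X U_(idx_x j) = 0%MM.
    by apply: mnm_tensP => l i; rewrite lead_XE mnm0E !mnm1E !idx_eq muln0.
  by rewrite mpolyX0 -mul_mpolyC mulr1.
by rewrite weighted_x; split; rewrite ?coefC // size_polyC leq_b1.
Qed.

Lemma leads_Y i l : leads (lead_weight U_(idx_Y i (lift ord0 l)))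
  (lead_coefw U_(idx_Y i (lift ord0 l))) (weighted (var_Y K i (lift ord0 l))).
Proof.
have -> : lead_weight U_(idx_Y i (lift ord0 l)) = (l == diag_row i).
  rewrite /lead_weight (bigD1 i) //= big1 ?addn0 => [|k nk].
    by rewrite !mnm1E !idx_eq eqxx /= (inj_eq lift_inj) addn0.
  by rewrite !mnm1E !idx_eq ![i == k]eq_sym (negPf nk).
have -> : lead_coefw U_(idx_Y i (lift ord0 l)) = - (x ord0) *: frame_var K l i.
  rewrite /lead_coefw off0_degree_Y expr1 scaleN1r rmorphN; congr (- _%:F *: 'X_[_]).
    congr 'X_[_]; apply/mnmP => k; rewrite mnmE off0_degree_Y !mnm1E idx_eq add0n.
    rewrite eq_sym; case: eqP => // _; rewrite big1 // => i' _.
    by rewrite mnm1E idx_eq andbF.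
  apply: mnm_tensP => l' i'; rewrite lead_XE !mnm1E !idx_eq andbF muln0 addn0.
  rewrite (inj_eq lift_inj).
  by rewrite (inj_eq (can_inj (@mxtens_indexK _ _))) xpair_eqE andbC.
rewrite weighted_Y; exact: leadsCXn.
Qed.

(** Among the terms of [weighted_Y0] only the one at [diag_row i] has degree one. *)
Lemma leads_Y0 i : leads (lead_weight U_(idx_Y i ord0))
  (lead_coefw U_(idx_Y i ord0)) (weighted (var_Y K i ord0)).
Proof.
have -> : lead_weight U_(idx_Y i ord0) = 1%N.
  rewrite /lead_weight (bigD1 i) //= big1 ?addn0 => [|k nk].
    by rewrite !mnm1E !idx_eq !eqxx.
  by rewrite !mnm1E !idx_eq ![i == k]eq_sym (negPf nk).
have -> : lead_coefw U_(idx_Y i ord0) = x (diag_col i) *: frame_var K (diag_row i) i.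
  rewrite /lead_coefw off0_degree_Y expr0 scale1r; congr (_%:F *: 'X_[_]).
    congr 'X_[_]; apply/mnmP => k; rewrite mnmE off0_degree_Y !mnm1E idx_eq add0n.
    case: eqP => [->|_]; first by rewrite eq_sym (negPf (neq_lift _ _)).
    rewrite eq_sym; case: eqP => [->|nk].
      rewrite (bigD1 i) //= big1 => [|i' /andP [_ ni]]; first by rewrite mnm1E !eqxx.
      by rewrite mnm1E idx_eq eq_sym (negPf ni).
    rewrite big1 // => i' /eqP Ek; rewrite mnm1E idx_eq eqxx andbT.
    by case: eqP => // Ei; case: nk; rewrite Ek Ei.
  apply: mnm_tensP => l' i'; rewrite lead_XE !mnm1E !idx_eq.
  rewrite (negPf (neq_lift _ _)) andbF add0n eqxx andbT.
  rewrite (inj_eq (can_inj (@mxtens_indexK _ _))) mulnb xpair_eqE.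
  by case: (i =P i') => [<-|_]; rewrite ?andbF // !andbT eq_sym.
rewrite weighted_Y0; split.
  apply: leq_trans (size_sum _ _ _) _; apply/bigmax_leqP => l _.
  by have [le _] := leadsCXn (l == diag_row i) (x (lift ord0 l) *: frame_var K l i);
    apply: leq_trans le _; rewrite ltnS leq_b1.
rewrite coef_sum (bigD1 (diag_row i)) //= big1 => [|l nl].
  by rewrite addr0 coefCM coefXn !eqxx mulr1.
by rewrite coefCM coefXn (negPf nl) mulr0.
Qed.

(** Weights add and leading coefficients multiply along products of monomials, so [leadsM] reduces
    the claim to 1 and the single variables. *)
Lemma leads_mono w : leads (lead_weight w) (lead_coefw w) (weighted 'X_[w]).
Proof.
have lv v : leads (lead_weight U_(v)) (lead_coefw U_(v)) (weighted 'X_v).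
  case: (idxP v) => [j|i j]; first exact: leads_x.
  case: (unliftP ord0 j) => [l ->|->]; [exact: leads_Y | exact: leads_Y0].
have leads0 : leads (lead_weight 0%MM) (lead_coefw 0%MM) (weighted 'X_[0%MM]).
  have o0 : off0_degree 0%MM = 0%N by apply: big1 => t _; rewrite mnm0E.
  have -> : lead_weight 0%MM = 0%N by apply: big1 => i _; rewrite !mnm0E.
  have -> : lead_coefw 0%MM = 1.
    rewrite /lead_coefw o0.
    have -> : lead_x 0%MM = 0%MM.
      apply/mnmP => j; rewrite mnmE o0 !mnm0E big1 ?if_same // => i _.
      by rewrite mnm0E.
    have -> : lead_X 0%MM = 0%MM.
      by apply: mnm_tensP => l i; rewrite lead_XE !mnm0E muln0.
    by rewrite expr0 !mpolyX0 !scale1r.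
  by rewrite mpolyX0 rmorph1; split; rewrite ?coefC // size_poly1.
have leadsD u v : leads (lead_weight u) (lead_coefw u) (weighted 'X_[u]) ->
    leads (lead_weight v) (lead_coefw v) (weighted 'X_[v]) ->
    leads (lead_weight (u + v)) (lead_coefw (u + v)) (weighted 'X_[u + v]).
  move=> lu lw; rewrite lead_weightD lead_coefwD mpolyXD weightedM.
  exact: leadsM lu lw.
pose Q u := leads (lead_weight u) (lead_coefw u) (weighted 'X_[u]).
rewrite -/(Q w) (multinomUE_id w); apply: (big_ind Q leads0 leadsD) => v _.
elim: (w v) => [|k IH]; first by rewrite mulm0n; exact: leads0.
by rewrite mulmS; exact: leadsD (lv v) IH.
Qed.

(** The leading data determine the exponent of [Y_(i,0)] plus that of [x_(i+1)], and the same plus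
    that of [Y_(i,i+1)]. One of the last two exponents is zero in a standard monomial, so the
    exponent of [Y_(i,0)] is the smaller sum; the other exponents follow by subtraction. *)
Lemma lead_inj u v : standard u -> standard v ->
  lead_x u = lead_x v -> lead_X u = lead_X v -> u = v.
Proof.
move=> su sv Ex EX.
have eX l i : (u (idx_Y i (lift ord0 l)) + (l == diag_row i) * u (idx_Y i ord0) =
    v (idx_Y i (lift ord0 l)) + (l == diag_row i) * v (idx_Y i ord0))%N.
  by rewrite -!lead_XE EX.
have ex i : (u (idx_x (diag_col i)) + u (idx_Y i ord0) =
    v (idx_x (diag_col i)) + v (idx_Y i ord0))%N.
  move: Ex => /mnmP /(_ (diag_col i)); rewrite !mnmE.
  rewrite eq_sym (negPf (neq_lift _ _)).
  have dc k : (diag_col i == diag_col k) = (k == i).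
    by rewrite (inj_eq lift_inj) eq_sym -!val_eqE.
  by rewrite !(eq_bigl _ _ dc) !big_pred1_eq.
have eY0 i : u (idx_Y i ord0) = v (idx_Y i ord0).
  have := eX (diag_row i) i; have := ex i; rewrite eqxx -/(diag_col i).
  have := forallP su i; have := forallP sv i; lia.
have eY i j : u (idx_Y i j) = v (idx_Y i j).
  case: (unliftP ord0 j) => [l ->|-> //].
  by have := eX l i; rewrite eY0; apply: addIn.
apply/mnmP => w; case: (idxP w) => // j.
move: Ex => /mnmP /(_ j); rewrite !mnmE.
(* The contributions of the [Y] to [lead_x] agree, since all their exponents do; what remains are
   the exponents of the [x_j]. *)
set s := (X in (u _ + X)%N); set s' := (X in (v _ + X)%N).
suff -> : s = s' by apply: addIn.
rewrite /s /s'; case: ifP => _; last by apply: eq_bigr => i _.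
apply: eq_bigr => t _; case: (mxtens_indexP t) => i k; exact: eY.
Qed.

(** Pick a monomial [w0] of [p] of maximal weight. By [lead_inj] no other monomial of that weight
    has the same leading term, so this term cannot cancel. *)
Lemma normal_chart0_inj p : normal p -> chart_map ord0 p = 0 -> p = 0.
Proof.
move=> np p0; apply/eqP; rewrite -msupp_eq0; apply/negPn/negP => sp0.
have exP : exists k, has (fun w => lead_weight w == k) (msupp p).
  case: (msupp p) sp0 => // w s _; exists (lead_weight w).
  by rewrite /= eqxx.
have ubP k : has (fun w => lead_weight w == k) (msupp p) ->
    (k <= \max_(w <- msupp p) lead_weight w)%N.
  by move=> /hasP [w wp /eqP <-]; apply: leq_bigmax_seq.
case: (ex_maxnP exP ubP) => k /hasP [w0 w0p /eqP Ek] kmax.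
have max w : w \in msupp p -> (lead_weight w <= k)%N.
  by move=> wp; apply: kmax; apply/hasP; exists w.
(* The contribution of [w] to the coefficient read off, kept as a polynomial in the [x_j] so that
   its coefficient at [lead_x w0] can be taken next. *)
pose g w : {mpoly K[n.+1]} := if (lead_weight w == k) && (lead_X w == lead_X w0)
  then p@_w *: ((-1) ^+ off0_degree w *: 'X_[lead_x w]) else 0.
have gE w : w \in msupp p ->
    ((weighted (p@_w *: 'X_[w]))`_k)@_(lead_X w0) = (g w)%:F.
  move=> wp; rewrite -mul_mpolyC rmorphM /= weightedC coefCM mul_mpolyC mcoeffZ.
  have [sw cw] := leads_mono w; rewrite /g.
  case: eqP => [<-|nk] /=; last first.
    by rewrite nth_default ?mcoeff0 ?mulr0 ?rmorph0 //;
      apply: leq_trans sw _; have := max w wp; lia.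
  rewrite cw /lead_coefw mcoeffZ mcoeffX.
  case: eqP => _; last by rewrite !mulr0 rmorph0.
  by rewrite mulr1 -rmorphM /= mul_mpolyC.
have : ((weighted p)`_k)@_(lead_X w0) = 0.
  by rewrite /weighted /= p0 rmorph0 coef0 mcoeff0.
rewrite {1}(mpolyE p) rmorph_sum coef_sum raddf_sum /= (eq_big_seq _ gE).
move=> /eqP; rewrite -rmorph_sum tofrac_eq0 => /eqP /(congr1 (mcoeff (lead_x w0))).
rewrite mcoeff0 raddf_sum /= (bigD1_seq w0) //= big1_seq => [|w /andP [nw wp]].
  rewrite /g Ek !eqxx /= !mcoeffZ mcoeffX eqxx mulr1 addr0 => /eqP.
  by rewrite mulf_eq0 signr_eq0 orbF mcoeff_eq0 w0p.
rewrite /g; case: andP => [[_ /eqP EX]|_]; last by rewrite mcoeff0.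
rewrite !mcoeffZ mcoeffX; case: eqP => [Ex|_]; last by rewrite !mulr0.
by rewrite (lead_inj (np w wp) (np w0 w0p) Ex EX) eqxx in nw.
Qed.

(** The chart kills the ideal, so the normal form of [p] also maps to zero and hence vanishes. *)
Lemma chart0_kernel p : chart_map ord0 p = 0 -> p \in @incidence_ideal K m n.
Proof.
move=> p0; have [q nq Iq] := reducible_all p.
suff q0 : q = 0 by rewrite q0 subr0 in Iq.
apply: (normal_chart0_inj nq); apply/eqP; rewrite -oppr_eq0; apply/eqP.
rewrite -[LHS]sub0r -{1}p0 -chart_mapB; exact: chart_map_ideal Iq.
Qed.

Lemma chart_kernel a p : chart_map a p = 0 -> p \in @incidence_ideal K m n.
Proof.
move=> pa; apply: chart0_kernel.
by rewrite -(frame_change_chart_map a ord0) pa rmorph0.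
Qed.

End NormalForms.

(** A monomial of [p] times a power of the other variable [X_j] occurs on the right, so its exponent
    at [i] is at least [k]. The witness divides [p] monomial by monomial. *)
Lemma mpolyX_coprime (R : nzRingType) (N : nat) (i j : 'I_N) (p q : {mpoly R[N]}) k l :
  i != j -> p * 'X_j ^+ l = q * 'X_i ^+ k -> exists r, p = r * 'X_i ^+ k.
Proof.
move=> nij E; exists (\sum_(w <- msupp p) p@_w *: 'X_[(w - U_(i) *+ k)%MM]).
rewrite {1}(mpolyE p) mulr_suml; apply: eq_big_seq => w wp.
rewrite mpolyXn -scalerAl -mpolyXD submK //; apply/mnm_lepP => v.
rewrite mulmnE mnm1E; case: eqP => [<-|_]; last by rewrite mul0n.
rewrite mul1n; have : (w + U_(j) *+ l)%MM \in msupp (q * 'X_i ^+ k).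
  by rewrite -E mpolyXn (perm_mem (msuppMX _ _)) addmC map_f.
rewrite mpolyXn (perm_mem (msuppMX _ _)) => /mapP [u _ /mnmP /(_ i)].
by rewrite !mnmDE !mulmnE !mnm1E eqxx eq_sym (negPf nij) mul0n addn0 mul1n => ->;
  rewrite leq_addr.
Qed.

(** * Global sections *)

Section Sections.
Variables (K : fieldType) (m n : nat).
Local Notation F := (homfrac K n).
Local Notation x := (@hcoord K n).
Local Notation TKm := (tensor_bundle (tangent_bundle K n) (trivial_bundle K n m)).

(** Membership in the localization at [x_a] of the image of [chart_map a]. *)
Definition localized (a : 'I_n.+1) (q : {mpoly F[n * m]}) : Prop :=
  exists e p, x a ^+ e *: q = chart_map a (p : xY_poly K m n).

Lemma localizedM a p q : localized a p -> localized a q -> localized a (p * q).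
Proof.
move=> [e [p' Ep]] [f [q' Eq]]; exists (e + f)%N, (p' * q').
by rewrite chart_mapM -Ep -Eq -scalerAl -scalerAr scalerA exprD.
Qed.

Lemma chart_map_xXn a j e :
  chart_map a (var_x K m j ^+ e) = (x j ^+ e)%:MP.
Proof. by rewrite rmorphXn /= chart_map_x -rmorphXn. Qed.

Lemma localizedD a p q : localized a p -> localized a q -> localized a (p + q).
Proof.
move=> [e [p' Ep]] [f [q' Eq]].
exists (e + f)%N, (p' * var_x K m a ^+ f + q' * var_x K m a ^+ e).
rewrite chart_mapD !chart_mapM -Ep -Eq !chart_map_xXn.
by rewrite ![_ * _%:MP]mulrC !mul_mpolyC !scalerA scalerDr exprD [x a ^+ f * _]mulrC.
Qed.

Lemma localized1 a : localized a 1.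
Proof. by exists 0%N, 1; rewrite scale1r rmorph1. Qed.

(** The frame vector is [x_a d/dx_j] with [j = lift a l], hence the image of [x_a Y_(i,j)]. *)
Lemma localized_frame_var a l i : localized a (frame_var K l i).
Proof.
exists 0%N, (var_x K m a * var_Y K i (lift a l)).
rewrite scale1r chart_mapM chart_map_x chart_map_Y /partial_section.
rewrite (bigD1 l) //= big1 ?addr0 => [|k nk].
  rewrite jac_coefE eqxx eq_sym (negPf (neq_lift _ _)) mul0r subr0 mul1r.
  by rewrite mul_mpolyC scalerA divff ?hcoord_neq0 // scale1r.
rewrite jac_coefE (inj_eq lift_inj) eq_sym (negPf nk) eq_sym (negPf (neq_lift _ _)).
by rewrite mul0r subr0 mul0r scale0r.
Qed.

Lemma chart_map_poly a (p : {mpoly K[n.+1]}) :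
  exists p' : xY_poly K m n, chart_map a p' = (p%:F)%:MP.
Proof.
move: p; apply: mpoly_ring_ind => [c|j|p q [p' Ep] [q' Eq]|p q [p' Ep] [q' Eq]].
- by exists c%:MP; rewrite chart_mapC.
- by exists (var_x K m j); rewrite chart_map_x.
- by exists (p' + q'); rewrite chart_mapD Ep Eq !rmorphD.
- by exists (p' * q'); rewrite chart_mapM Ep Eq !rmorphM.
Qed.

Lemma localizedC a d f : twist_section d 'X_a f -> localized a f%:MP.
Proof.
move=> [e [_ [_ [p [_ _ _ ->]]]]]; have [p' Ep] := chart_map_poly a p.
exists e, p'; rewrite Ep -mul_mpolyC -rmorphM; congr (_%:MP).
by rewrite mulrC divfK // expf_neq0 // hcoord_neq0.
Qed.

Lemma localized_section a d q : (forall w, twist_section d 'X_a q@_w) -> localized a q.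
Proof.
move=> tq; rewrite (mpolyE q).
apply: (big_ind (localized a)) => [||w _]; [|exact: localizedD|].
  by exists 0%N, 0; rewrite scaler0 rmorph0.
rewrite -mul_mpolyC; apply: localizedM; first exact: localizedC (tq w).
rewrite mpolyXE_id; apply: (big_ind (localized a)) => [||t _];
  [exact: localized1|exact: localizedM|].
elim: (w t) => [|k IH]; first exact: localized1.
rewrite exprS; apply: localizedM IH; case: (mxtens_indexP t) => l i.
exact: localized_frame_var.
Qed.

Lemma section_chart_family (lt_mn : (m < n)%N) k d s :
  is_section TKm k d s -> exists p, s = chart_family p.
Proof.
move=> [_ ts fs]; pose le_mn := ltnW lt_mn.
(* Reduction modulo the ideal preserves the image, so the numerator may be taken in normal form. *)
have normal_num a : exists e p, normal le_mn p /\ x a ^+ e *: s a = chart_map a p.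
  have [e [p Ep]] := localized_section (ts a); have [q nq Iq] := reducible_all le_mn p.
  exists e, q; split; [exact: nq | apply/eqP].
  rewrite Ep -subr_eq0 -chart_mapB; apply/eqP.
  exact: chart_map_ideal Iq.
have [e [p [np Ep]]] := normal_num ord0.
have [f [q [nq Eq]]] := normal_num ord_max.
(* Frame changes are linear over [F], so the fraction over [U_n] can be compared in the frame over
   [U_0]. *)
have {}Eq : x ord_max ^+ f *: s ord0 = chart_map ord0 q.
  by rewrite -(frame_change_chart_map ord_max) -Eq -(fs ord_max ord0)
    /frame_change comp_mpolyZ.
have Epq : p * var_x K m ord_max ^+ f = q * var_x K m ord0 ^+ e.
  apply/eqP; rewrite -subr_eq0; apply/eqP/(normal_chart0_inj (le_mn := le_mn)).
    (* Diagonal columns satisfy [0 < i + 1 <= m < n], so [x_0] and [x_n] are harmless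
       multipliers. *)
    apply: normalB; apply: normalMx => // i.
    by rewrite -val_eqE /= /bump /=; have := ltn_ord i; lia.
  rewrite chart_mapB !chart_mapM -Ep -Eq !chart_map_xXn ![_ * _%:MP]mulrC !mul_mpolyC.
  by rewrite !scalerA mulrC subrr.
have [|r Er] := mpolyX_coprime _ Epq.
  by rewrite idx_x_eq -val_eqE /=; lia.
exists r; have E0 : s ord0 = chart_map ord0 r.
  apply: (scalerI (a := x ord0 ^+ e)); first by rewrite expf_neq0 ?hcoord_neq0.
  by rewrite Ep Er chart_mapM chart_map_xXn mulrC mul_mpolyC.
(* A section is determined by its value in one chart. *)
apply/ffunP => a; rewrite [RHS]ffunE -(frame_change_chart_map ord0 a) -E0.
exact: esym (fs ord0 a).
Qed.

Lemma cox_elem_chart_familyP (lt_mn : (m < n)%N) s :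
  cox_elem TKm s -> exists p, s = chart_family p.
Proof.
move=> [u [t [_ ht ->]]]; rewrite big_seq.
apply: (big_ind (fun s => exists p, s = chart_family p)) => [|_ _ [p ->] [q ->]|kd kdu].
- by exists 0; rewrite rmorph0.
- by exists (p + q); rewrite rmorphD.
- exact: section_chart_family lt_mn _ _ _ (ht kd kdu).
Qed.

(** * The isomorphism from the presented ring to the Cox ring *)

Definition cox_of_poly (p : xY_poly K m n) : cox_ring TKm :=
  CoxRing (introT (asboolP _) (cox_elem_chart_family p)).

Definition cox_of_quot (z : presented_ring K m n) : cox_ring TKm := cox_of_poly (repr z).

(** Two representatives differ by an element of the ideal, which every chart kills. *)
Lemma cox_of_quot_pi p : cox_of_quot (\pi p) = cox_of_poly p.
Proof.
apply: val_inj => /=; apply/eqP; rewrite -subr_eq0 -rmorphB; apply/eqP/ffunP => a.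
rewrite !ffunE; apply: chart_map_ideal.
by rewrite Quotient.idealrBE; apply/eqP; rewrite reprK.
Qed.

Lemma cox_of_quot_zmod_morphism : zmod_morphism cox_of_quot.
Proof.
move=> y z; rewrite -[y]reprK -[z]reprK -rmorphB /= !cox_of_quot_pi.
by apply: val_inj; rewrite rmorphB /= rmorphB.
Qed.

Lemma cox_of_quot_monoid_morphism : monoid_morphism cox_of_quot.
Proof.
split.
  by rewrite -(rmorph1 \pi) cox_of_quot_pi; apply: val_inj; rewrite /= !rmorph1.
move=> y z; rewrite -[y]reprK -[z]reprK -rmorphM /= !cox_of_quot_pi.
by apply: val_inj; rewrite rmorphM /= rmorphM.
Qed.

HB.instance Definition _ :=
  GRing.isZmodMorphism.Build _ _ cox_of_quot cox_of_quot_zmod_morphism.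
HB.instance Definition _ :=
  GRing.isMonoidMorphism.Build _ _ cox_of_quot cox_of_quot_monoid_morphism.

(** The chart over [U_0] alone already has the incidence ideal as its kernel. *)
Lemma cox_of_quot_inj (le_mn : (m <= n)%N) : injective cox_of_quot.
Proof.
move=> y z; rewrite -[y]reprK -[z]reprK !cox_of_quot_pi => /(congr1 val) /= E.
apply/eqmodP; rewrite /= Quotient.equivE; apply: (chart_kernel le_mn (a := ord0)).
by rewrite chart_mapB -!chart_familyE E subrr.
Qed.

Lemma cox_of_quot_surj (lt_mn : (m < n)%N) s : exists z, cox_of_quot z = s.
Proof.
case: s => s hs; have /asboolP /(cox_elem_chart_familyP lt_mn) [p Ep] := hs.
by exists (\pi p); rewrite cox_of_quot_pi; apply: val_inj.
Qed.

End Sections.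

Theorem proposition6p4 (K : closedFieldType) (m n : nat)
    (hm : (1 <= m)%N) (hmn : (m < n)%N) :
  exists phi : {rmorphism presented_ring K m n ->
                  cox_ring (tensor_bundle (tangent_bundle K n) (trivial_bundle K n m))},
    bijective phi /\ (forall c : K, phi (presented_const m n c) = cox_const _ c).
Proof.
exists (@cox_of_quot K m n); split.
  (* Surjectivity yields a right inverse by choice, and injectivity makes it two-sided. *)
  have [g gK] := choice (@cox_of_quot_surj K m n hmn).
  exists g; last exact: gK.
  by move=> z; exact: (cox_of_quot_inj (ltnW hmn) (gK _)).
move=> c; rewrite /presented_const /= cox_of_quot_pi; apply: val_inj.
exact: chart_familyC.
Qed.
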